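(* Let $p\geq 3$ be any fixed prime integer, and for $c\in\mathbb{Z}_p$ let $\varphi_{p,c}$ be the polynomial map defined by $\varphi_{p,c}(z)=z^p+c$ for all $z\in\mathbb{Z}_p$. Then for every $c\in\mathbb{Z}_p$ the number of distinct $p$-adic integral fixed points of $\varphi_{p,c}$ modulo $p\mathbb{Z}_p$ is $p$ or $0$.
   Context: $\mathbb{Z}_p$ is the ring of $p$-adic integers. The number of distinct $p$-adic integral fixed points of $\varphi_{p,c}$ modulo $p\mathbb{Z}_p$ means $\#\{z\in\mathbb{Z}_p/p\mathbb{Z}_p : \varphi_{p,c}(z)-z\equiv 0 \pmod{p\mathbb{Z}_p}\}$. *)

(* Defs.v *)
From HB Require Import structures.
From mathcomp Require Import all_boot all_order all_algebra.
From mathcomp Require Import generic_quotient ring_quotient.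
From mathcomp Require Import ring.
From mathcomp Require Import boolp classical_sets functions cardinality.

Set Implicit Arguments.
Unset Strict Implicit.
Unset Printing Implicit Defensive.

Import GRing.Theory.
Local Open Scope ring_scope.
Local Open Scope quotient_scope.
Local Open Scope classical_set_scope.

(* The inverse limit of the rings Z/p^(n+1), n >= 0, along the reduction maps.
   Exponents start at 1 because 'Z_1 is Z/2 and not the zero ring. For p <= 1
   (where 'Z_(p ^ n.+1) is Z/2 at every level) the type is meaningless. *)
Record padic_int (p : nat) := PadicInt {
  padic_res :> forall n : nat, 'Z_(p ^ n.+1);
  padic_resP : forall n : nat, inZp (padic_res n.+1) = padic_res n }.

HB.instance Definition _ (p : nat) := gen_eqMixin (padic_int p).
HB.instance Definition _ (p : nat) := gen_choiceMixin (padic_int p).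

Section PadicRing.
Variable p : nat.
Implicit Types x y z : padic_int p.

Lemma padicP x y : (forall n, x n = y n) -> x = y.
Proof.
case: x y => [x xP] [y yP] /= eq_xy.
have {}eq_xy : x = y by apply: functional_extensionality_dep.
by rewrite eq_xy in xP *; congr PadicInt; apply: Prop_irrelevance.
Qed.

Lemma Zp_trunc_dvd n :
  ((Zp_trunc (p ^ n.+1)).+2 %| (Zp_trunc (p ^ n.+2)).+2)%N.
Proof.
case: p => [|[|q]]; rewrite ?exp0n ?exp1n //.
by rewrite !Zp_cast ?dvdn_exp2l // -[1%N](expn0 q.+2) ltn_exp2l.
Qed.

Fact padic_zero_subproof n : inZp (0%R : 'Z_(p ^ n.+2)) = 0 :> 'Z_(p ^ n.+1).
Proof. by apply: val_inj; rewrite /= mod0n. Qed.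

Fact padic_one_subproof n : inZp (1%R : 'Z_(p ^ n.+2)) = 1 :> 'Z_(p ^ n.+1).
Proof. by apply: val_inj; rewrite /= modn_dvdm // Zp_trunc_dvd. Qed.

Fact padic_opp_subproof x n : inZp (- x n.+1)%R = - x n.
Proof.
rewrite -[x n]padic_resP; apply/eqP; rewrite -addr_eq0; apply/eqP.
apply: val_inj; rewrite /= modn_dvdm ?Zp_trunc_dvd // modnDm subnK.
  by apply/eqP; exact: Zp_trunc_dvd.
by rewrite ltnW // ltn_ord.
Qed.

Fact padic_add_subproof x y n : inZp (x n.+1 + y n.+1)%R = x n + y n.
Proof.
rewrite -[x n]padic_resP -[y n]padic_resP; apply: val_inj.
by rewrite /= modn_dvdm ?Zp_trunc_dvd // modnDm.
Qed.

Fact padic_mul_subproof x y n : inZp (x n.+1 * y n.+1)%R = x n * y n.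
Proof.
rewrite -[x n]padic_resP -[y n]padic_resP; apply: val_inj.
by rewrite /= modn_dvdm ?Zp_trunc_dvd // modnMm.
Qed.

Definition padic_zero := PadicInt padic_zero_subproof.
Definition padic_one := PadicInt padic_one_subproof.
Definition padic_opp x := PadicInt (padic_opp_subproof x).
Definition padic_add x y := PadicInt (padic_add_subproof x y).
Definition padic_mul x y := PadicInt (padic_mul_subproof x y).

Fact padic_addA : associative padic_add.
Proof. by move=> x y z; apply: padicP => n; exact: addrA. Qed.

Fact padic_addC : commutative padic_add.
Proof. by move=> x y; apply: padicP => n; exact: addrC. Qed.

Fact padic_add0 : left_id padic_zero padic_add.
Proof. by move=> x; apply: padicP => n; exact: add0r. Qed.

Fact padic_addN : left_inverse padic_zero padic_opp padic_add.
Proof. by move=> x; apply: padicP => n; exact: addNr. Qed.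

HB.instance Definition _ :=
  GRing.isZmodule.Build (padic_int p) padic_addA padic_addC padic_add0
    padic_addN.

Fact padic_mulA : associative padic_mul.
Proof. by move=> x y z; apply: padicP => n; exact: mulrA. Qed.

Fact padic_mulC : commutative padic_mul.
Proof. by move=> x y; apply: padicP => n; exact: mulrC. Qed.

Fact padic_mul1 : left_id padic_one padic_mul.
Proof. by move=> x; apply: padicP => n; exact: mul1r. Qed.

Fact padic_mulD : left_distributive padic_mul padic_add.
Proof. by move=> x y z; apply: padicP => n; exact: mulrDl. Qed.

Fact padic_one_neq0 : padic_one != 0.
Proof.
by apply/eqP => /(congr1 (fun x : padic_int p => x 0)) /eqP; exact/negP/oner_neq0.
Qed.

HB.instance Definition _ :=
  GRing.Zmodule_isComNzRing.Build (padic_int p) padic_mulA padic_mulC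
    padic_mul1 padic_mulD padic_one_neq0.

End PadicRing.

Definition pZp (p : nat) : {pred padic_int p} :=
  fun x => `[< exists y : padic_int p, x = p%:R * y >].

Fact pZp_zmod_closed (p : nat) : zmod_closed (@pZp p).
Proof.
split=> [|x y /asboolP[a ->] /asboolP[b ->]]; apply/asboolP.
  by exists 0; rewrite mulr0.
by exists (a - b); rewrite mulrBr.
Qed.

HB.instance Definition _ (p : nat) :=
  GRing.isZmodClosed.Build (padic_int p) (@pZp p) (@pZp_zmod_closed p).

Notation Zp_mod_p p := {ideal_quot (@pZp p)}.

Definition phi (p : nat) (c z : padic_int p) : padic_int p := z ^+ p + c.

Definition fixed_points_mod (p : nat) (c : padic_int p) : set (Zp_mod_p p) :=
  \pi_(Zp_mod_p p) @` [set z : padic_int p | phi c z - z \in @pZp p].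

(* Being a fixed point modulo p does not depend on the representative. *)
Lemma fixed_points_modE (p : nat) (c z : padic_int p) :
  fixed_points_mod c (\pi z) <-> phi c z - z \in @pZp p.
Proof.
split=> [[w /= wP /eqP]|zP]; last by exists z.
rewrite piE /Quotient.equiv /= => wz.
suff : phi c w - w - (phi c z - z) \in @pZp p.
  by move=> /(rpredB wP); rewrite subKr.
have -> : phi c w - w - (phi c z - z) = (w ^+ p - z ^+ p) - (w - z).
  by rewrite /phi; ring.
rewrite rpredB // subrXX; case/asboolP: wz => y ->.
by apply/asboolP; rewrite -mulrA; eexists.
Qed.

(* Main.v *)
Require Import Defs.
From mathcomp Require Import all_boot all_algebra.
From mathcomp Require Import generic_quotient ring_quotient boolp.
From mathcomp Require Import classical_sets cardinality.

Import GRing.Theory.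

Local Open Scope classical_set_scope.
Local Open Scope card_scope.

(** Reduction modulo [p] identifies [Z_p / pZ_p] with the field of [p] elements,
    represented here by the bottom level ['Z_(p ^ 1)] of the inverse limit: its
    kernel is exactly [pZp] ([pZpE]), and every class contains exactly one of
    the integers [0, ..., p - 1] ([card_padic_modp]).  By Fermat's little theorem
    [z ^ p - z] vanishes modulo [p] for every [z], so [phi c z - z] is congruent
    to [c] whatever [z] is ([phi_subr_pZp]).  The fixed-point condition thus
    does not depend on [z]: if [p] divides [c] all [p] classes satisfy it,
    otherwise none does. *)

Section ReductionModP.
Local Open Scope ring_scope.
Variable p : nat.
Hypothesis p_prime : prime p.
Implicit Types (c x z : padic_int p) (k n : nat).

Lemma level_gt1 n : (1 < p ^ n.+1)%N.
Proof. by rewrite -[1%N](expn0 p) ltn_exp2l // prime_gt1. Qed.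

Lemma padic_natE k n : (k%:R : padic_int p) n = k%:R.
Proof. by elim: k => // k IHk; rewrite [in LHS]mulrS [RHS]mulrS -IHk. Qed.

Lemma padic_expE x k n : (x ^+ k) n = x n ^+ k.
Proof. by elim: k => // k IHk; rewrite [in LHS]exprS [RHS]exprS -IHk. Qed.

Lemma padic_val_mod z n : (z n.+1 %% p ^ n.+1)%N = z n :> nat.
Proof. by rewrite -(padic_resP z n) /= (Zp_cast (level_gt1 n)). Qed.

Lemma dvdn_padic_val z : z 0 = 0 -> forall n, (p %| z n)%N.
Proof.
move=> z0; elim=> [|n IHn]; first by rewrite z0 /= dvdn0.
move: IHn; rewrite -(padic_val_mod z n).
by rewrite /dvdn modn_dvdm // expnS dvdn_mulr.
Qed.

(** Dividing by [p] costs one level of precision: knowing [z] modulo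
    [p ^ n.+2] gives [z / p] modulo [p ^ n.+1] only, whence the shift. *)
Lemma padic_divp_subproof z n :
  inZp (inZp (z n.+2 %/ p)%N : 'Z_(p ^ n.+2))
    = inZp (z n.+1 %/ p)%N :> 'Z_(p ^ n.+1).
Proof.
apply: val_inj; rewrite /= modn_dvdm ?Zp_trunc_dvd //.
rewrite (Zp_cast (level_gt1 n)) -(padic_val_mod z n.+1).
by rewrite [(p ^ n.+2)%N]expnSr -modn_divl modn_mod.
Qed.

Definition padic_divp z := PadicInt (padic_divp_subproof z).

(** At level [n] the quotient comes from a multiple of [p] at level [n.+1],
    where the division is exact; reducing the product back to level [n] returns
    [z n]. *)
Lemma mulp_padic_divp z : z 0 = 0 -> p%:R * padic_divp z = z.
Proof.
move=> z0; apply: padicP => n.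
transitivity ((p%:R : padic_int p) n * padic_divp z n) => //.
rewrite padic_natE /= -Zp_nat -natrM mulnC divnK ?dvdn_padic_val //.
by rewrite Zp_nat padic_resP.
Qed.

Lemma pZpE z : (z \in @pZp p) = (z 0 == 0).
Proof.
apply/asboolP/eqP => [[y ->]|/mulp_padic_divp <-]; last by eexists.
transitivity ((p%:R : padic_int p) 0 * y 0) => //.
by rewrite padic_natE -[X in X%:R]expn1 pchar_Zp ?mul0r ?level_gt1.
Qed.

Lemma fermat_level0 (x : 'Z_(p ^ 1)) : x ^+ p = x.
Proof.
rewrite -[x]natr_Zp -natrX; apply: ord_inj.
rewrite !(val_Zp_nat (level_gt1 0)); move: (nat_of_ord x) => k.
by rewrite expn1 fermat_little.
Qed.

Lemma phi_subr_pZp c z : (phi c z - z \in @pZp p) = (c \in @pZp p).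
Proof.
rewrite !pZpE; suff -> : (phi c z - z) 0 = c 0 by [].
transitivity ((z ^+ p) 0 + c 0 - z 0) => //.
by rewrite padic_expE fermat_level0 addrAC subrr add0r.
Qed.

Lemma eq_pi_level0 x z :
  (\pi_(Zp_mod_p p) x = \pi_(Zp_mod_p p) z)%qT <-> x 0 = z 0.
Proof.
have E : (x - z \in @pZp p) = (x 0 == z 0) by rewrite pZpE -[RHS]subr_eq0.
split=> [/eqP|/eqP]; first by rewrite -Quotient.idealrBE E => /eqP.
by rewrite -E Quotient.idealrBE => /eqP.
Qed.

(** The integers [0, ..., p - 1] are representatives: the class of [z] is that
    of the integer representing [z 0]. *)
Lemma card_padic_modp : [set: Zp_mod_p p] #= `I_p.
Proof.
pose f k : Zp_mod_p p := (\pi_(Zp_mod_p p) (k%:R))%qT.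
suff <- : f @` `I_p = [set: Zp_mod_p p].
  apply: inj_card_eq => k l; rewrite !inE /= => ltkp ltlp /eq_pi_level0.
  rewrite !padic_natE => /(congr1 (@nat_of_ord _)).
  by rewrite !(val_Zp_nat (level_gt1 0)) expn1 !modn_small.
rewrite -subTset => u _; exists (nat_of_ord (repr u 0)).
  by rewrite /= -[ltnRHS]expn1 -[ltnRHS](Zp_cast (level_gt1 0)) ltn_ord.
by rewrite -[RHS]reprK; apply/eq_pi_level0; rewrite padic_natE natr_Zp.
Qed.

End ReductionModP.

Theorem theorem1p2 (p : nat) (p_prime : prime p) (p_ge3 : (3 <= p)%N)
    (c : padic_int p) :
  fixed_points_mod c #= `I_p \/ fixed_points_mod c #= `I_0.
Proof.
have [cP|cNP] := boolP (c \in @pZp p); [left | right].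
  have -> : fixed_points_mod c = [set: Zp_mod_p p].
    rewrite -subTset => u _; rewrite -[u]reprK.
    by apply/fixed_points_modE; rewrite phi_subr_pZp.
  exact: card_padic_modp.
rewrite II0 card_eq0; apply/eqP; rewrite -subset0 => u [z /=].
by rewrite phi_subr_pZp // (negPf cNP).
Qed.
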